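(* (i) For every null set $A\subseteq 2^\omega$ and every perfect tree $T\subseteq 2^{<\omega}$ there exists a perfect tree $T'\subseteq T$ such that for every $n\in\omega$ the set $A+\underbrace{[T']+[T']+\dots+[T']}_{n\text{ times}}$ is null. (ii) For every null set $A\subseteq 2^\omega$ and every uniformly perfect tree $T\subseteq 2^{<\omega}$ there exists a uniformly perfect tree $T'\subseteq T$ such that for every $n\in\omega$ the set $A+\underbrace{[T']+[T']+\dots+[T']}_{n\text{ times}}$ is null.
   Context: Null means of measure zero with respect to the standard product (Haar) probability measure on $2^\omega$. A tree is a nonempty set $T\subseteq 2^{<\omega}$ closed under initial segments. Write $\mathrm{split}(T)=\{\sigma\in T:\sigma^\frown 0\in T\text{ and }\sigma^\frown 1\in T\}$ and $[T]=\{x\in 2^\omega:(\forall n\in\omega)\ x\upharpoonright n\in T\}$. $T$ is perfect if for every $\sigma\in T$ there is $\tau\in\mathrm{split}(T)$ with $\sigma\subseteq\tau$. $T$ is uniformly perfect if it is perfect and for every $n\in\omega$ either $2^n\cap T\subseteq\mathrm{split}(T)$ or $2^n\cap\mathrm{split}(T)=\emptyset$. On $2^\omega$, $+$ is coordinatewise addition modulo $2$, and $A+B=\{a+b:a\in A,\ b\in B\}$ for $A,B\subseteq 2^\omega$; for $n=0$ the displayed set is read as $A$ itself. *)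

(* Defs.v *)
From HB Require Import structures.
From mathcomp Require Import all_boot all_order all_algebra.
From mathcomp Require Import all_classical all_reals all_analysis.

Set Implicit Arguments.
Unset Strict Implicit.
Unset Printing Implicit Defensive.

Import Order.TTheory GRing.Theory Num.Theory.
Import numFieldNormedType.Exports.

Local Open Scope classical_set_scope.
Local Open Scope ring_scope.

Definition restr (x : cantor_space) (n : nat) : seq bool := mkseq x n.

Definition cylinder (s : seq bool) : set cantor_space :=
  [set x | restr x (size s) = s].

Definition pad (s : seq bool) : cantor_space := nth false s.

Lemma restrP (x y : cantor_space) n :
  (forall i, (i < n)%N -> x i = y i) <-> restr x n = restr y n.
Proof.
split=> [h|h i ltin].
  by apply/eq_in_map => i; rewrite mem_iota add0n; exact: h.
by rewrite -(nth_mkseq false x ltin) -/(restr x n) h nth_mkseq.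
Qed.

Lemma size_restr x n : size (restr x n) = n.
Proof. exact: size_mkseq. Qed.

Lemma restr_pad s : restr (pad s) (size s) = s.
Proof. exact: mkseq_nth. Qed.

Lemma restr_pad_le s n : (n <= size s)%N -> restr (pad s) n = take n s.
Proof.
move=> le; apply: (@eq_from_nth _ false) => [|i].
  by rewrite size_restr size_takel.
by rewrite size_restr => lt; rewrite nth_mkseq// nth_take.
Qed.

Lemma cylinder_nbhs (x : cantor_space) (U : set cantor_space) :
  nbhs x U -> exists n, cylinder (restr x n) `<=` U.
Proof.
pose F := filter_from [set: nat] (fun n => cylinder (restr x n)).
have FF : Filter F.
  apply: filter_from_filter; first by exists 0%N.
  move=> i j _ _; exists (maxn i j) => // y.
  rewrite /cylinder /mkset !size_restr => /restrP h; split; apply/restrP => k kl;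
    by apply: h; rewrite leq_max kl ?orbT.
have Fx : F `=>` nbhs x.
  have : forall t : nat, g t @[g --> F] --> x t.
    move=> t V /= /nbhs_singleton Vx.
    exists t.+1 => // y; rewrite /cylinder /mkset size_restr => /restrP h.
    by rewrite /preimage /= h.
  move/(@pointwise_cvgP nat bool F x FF).
  by rewrite (@pointwise_cvg_family_singleton nat bool F x FF).
by move=> /Fx [n _ h]; exists n.
Qed.

Lemma coord_clopen i b : clopen [set x : cantor_space | x i = b].
Proof.
have -> : [set x : cantor_space | x i = b] =
    (fun x : cantor_space => x i) @^-1` [set b] by [].
apply: (@preimage_clopen cantor_space bool); first by split; [exact: discrete_open | exact: discrete_closed].
exact: (@proj_continuous nat (fun=> bool) i).
Qed.

Lemma cylinder_clopen s : clopen (cylinder s).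
Proof.
have -> : cylinder s =
    \big[setI/setT]_(i < size s) [set x : cantor_space | x i = nth false s i].
  rewrite -(bigcap_mkord _ (fun i => [set x : cantor_space | x i = nth false s i])).
  apply/seteqP; split => x /=.
    rewrite /cylinder /= => xs i /= lt.
    by rewrite -[in RHS]xs nth_mkseq.
  move=> h; rewrite /cylinder /= -[RHS]restr_pad; apply/restrP => i lt.
  exact: h.
by elim/big_ind: _ => [|A B|i _];
  [exact: clopenT | exact: clopenI | exact: coord_clopen].
Qed.

Definition determined (C : set cantor_space) n :=
  forall x y, restr x n = restr y n -> C x -> C y.

Lemma determinedW C m n : (m <= n)%N -> determined C m -> determined C n.
Proof.
move=> le h x y /restrP e; apply: h; apply/restrP => i lt.
exact: e (leq_trans lt le).
Qed.

Lemma clopen_determined (C : set cantor_space) :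
  clopen C -> exists n, determined C n.
Proof.
move=> [oC cC].
pose f n := [set x | cylinder (restr x n) `<=` C \/
                     cylinder (restr x n) `<=` ~` C].
have := cantor_space_compact; rewrite compact_cover => /(_ nat setT f).
case=> [n _|x _|D _ Dcov].
- have -> : f n = \bigcup_(x in f n) cylinder (restr x n).
    apply/seteqP; split => [x fx|y [x fx]]; first by exists x => //;
      rewrite /cylinder /mkset size_restr.
    by rewrite /cylinder /f /mkset size_restr => ->.
  by apply: bigcup_open => x _; case: (cylinder_clopen (restr x n)).
- have [Cx|Cx] := pselect (C x).
    have [|n h] := @cylinder_nbhs x C; first exact: open_nbhs_nbhs.
    by exists n => //; left.
  have [|n h] := @cylinder_nbhs x (~` C).
    by apply: open_nbhs_nbhs; split => //; exact: closed_openC.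
  by exists n => //; right.
exists (\max_(i <- finmap.enum_fset D) i)%N => x y exy Cx.
have [n nD fn] := Dcov x I.
have len : (n <= \max_(i <- finmap.enum_fset D) i)%N.
  exact: (@leq_bigmax_seq _ _ predT id).
have enxy : restr y n = restr x n.
  apply/restrP => i lt; apply/esym; move/restrP: exy; apply.
  exact: leq_trans lt len.
case: fn => h.
  by apply: h; rewrite /cylinder /mkset size_restr.
by case: (h x) => //; rewrite /cylinder /mkset size_restr.
Qed.

(* The proportion of the strings s of length n such that s000... is in C; for
   clopen C it is constant for large n. *)
Definition density (R : realType) (n : nat) (C : set cantor_space) : R :=
  #|[set s : n.-tuple bool | pad s \in C]%SET|%:R / 2 ^+ n.

(* The algebra of clopen sets, on an alias of the Cantor space; the sigma-algebra
   it generates is the Borel one. *)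
Definition clopen_space : Type := cantor_space.

HB.instance Definition _ := Pointed.on clopen_space.

Definition clopen_display : measure_display.
Proof. exact: default_measure_display. Qed.

HB.instance Definition _ := @isAlgebraOfSets.Build clopen_display clopen_space
  (@clopen cantor_space) clopen0 clopenU (fun A => @clopenC cantor_space A setT).

Definition premeasure (R : realType) (C : set clopen_space) : \bar R :=
  (limn (fun n => density R n C))%:E.

Section coin_measure.
Variable R : realType.
Local Notation mu0 := (@premeasure R).

Lemma density_ge0 n C : 0 <= density R n C.
Proof. by rewrite divr_ge0 ?exprn_ge0. Qed.

Lemma densityU n A B : A `&` B = set0 ->
  density R n (A `|` B) = density R n A + density R n B.
Proof.
move=> AB; rewrite /density -mulrDl -natrD; congr (_%:R / _).
rewrite -cardsUI [X in (_ + X)%N]eq_card0 ?addn0.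
  by apply: eq_card => s; rewrite !inE in_setU.
move=> s; rewrite !inE; apply/negbTE/negP => /andP[/set_mem As /set_mem Bs].
by have : (A `&` B) (pad s) by []; rewrite AB.
Qed.

Lemma densityS n C : determined C n -> density R n.+1 C = density R n C.
Proof.
move=> dC; rewrite /density.
set D := [set s : n.-tuple bool | pad s \in C]%SET.
have -> : [set s : n.+1.-tuple bool | pad s \in C]%SET =
  [set [tuple of rcons (p : n.-tuple bool * bool).1 p.2]
    | p in finset.setX D [set: bool]%SET]%SET.
  have memE (u : n.-tuple bool) b : (pad (rcons u b) \in C) = (pad u \in C).
    apply/idP/idP => /set_mem h; apply/mem_set; apply: dC h;
    by rewrite !restr_pad_le ?size_rcons ?size_tuple// -cats1
         takel_cat ?size_tuple.
  apply/setP => s; rewrite inE; apply/idP/imsetP.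
    case/tupleP: s => x s; pose t := [tuple of x :: s].
    have st : size (belast x s) == n by rewrite size_belast size_tuple.
    move=> h; exists (Tuple st, last x s) => /=.
      by rewrite !inE andbT -(memE _ (last x s)) /= -lastI.
    by apply: val_inj; rewrite /= -lastI.
  move=> [[u b] /=]; rewrite !inE andbT => h ->; apply: set_mem.
  by rewrite (memE u b).
rewrite card_imset; last first.
  move=> [u b] [v c] /= /(congr1 val) /= /rcons_inj [uv ->].
  by congr pair; apply: val_inj.
rewrite cardsX cardsT card_bool natrM exprS invfM mulrA.
by rewrite -!mulrA; congr (_ * _); rewrite mulrA divff ?mul1r.
Qed.

Lemma density_stable m n C : determined C m -> (m <= n)%N ->
  density R n C = density R m C.
Proof.
move=> dC; elim: n => [|n IH]; first by rewrite leqn0 => /eqP ->.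
rewrite leq_eqVlt => /predU1P[->//|]; rewrite ltnS => le.
by rewrite densityS ?IH//; exact: determinedW dC.
Qed.

Lemma premeasure_density n C : determined C n -> mu0 C = (density R n C)%:E.
Proof.
move=> dC; congr EFin; apply: norm_lim_near_cst.
by exists n => // k /= le; exact: density_stable.
Qed.

Lemma premeasure_ge0 C : (0 <= mu0 C)%E.
Proof.
rewrite lee_fin; have [cv|/dvgP ->//] := pselect (cvgn (fun n => density R n C)).
by apply: limr_ge => //; apply: nearW => n; exact: density_ge0.
Qed.

Lemma premeasure_additive : measure_function.semi_additive mu0.
Proof.
have mu00 : mu0 set0 = 0%E.
  rewrite (@premeasure_density 0) // /density.
  by rewrite eq_card0 ?mul0r// => s; rewrite !inE in_set0.
apply/(additive2P mu00) => A B cA cB AB.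
have [[m dA] [n dB]] := (clopen_determined cA, clopen_determined cB).
have dA' : determined A (maxn m n) := determinedW (leq_maxl _ _) dA.
have dB' : determined B (maxn m n) := determinedW (leq_maxr _ _) dB.
rewrite !(@premeasure_density (maxn m n))// ?densityU// => x y e [?|?].
- by left; exact: dA' e _.
- by right; exact: dB' e _.
Qed.

HB.instance Definition _ := isContent.Build clopen_display clopen_space R
  mu0 premeasure_ge0 premeasure_additive.

Lemma premeasure_sigma_subadditive : measurable_subset_sigma_subadditive mu0.
Proof.
move=> A F cF cA AF.
have : compact (A : set cantor_space).
  apply: (subclosed_compact _ cantor_space_compact) => //; exact: cA.2.
rewrite compact_cover => /(_ nat setT F) [n _|//|D _ AD]; first exact: (cF n).1.
set N := (\max_(i <- finmap.enum_fset D) i).+1%N.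
apply: (@le_trans _ _ (\sum_(k < N) mu0 (F k))%E).
  apply: (@content_subadditive _ _ _ mu0) => //.
  move=> x /AD [n nD Fx]; rewrite -bigcup_mkord; exists n => //=.
  by rewrite ltnS; exact: (@leq_bigmax_seq _ _ predT id).
rewrite -(big_mkord predT (fun k => mu0 (F k))).
by apply: nneseries_lim_ge => k _ _; exact: premeasure_ge0.
Qed.

HB.instance Definition _ :=
  Content_SigmaSubAdditive_isMeasure.Build clopen_display R clopen_space
    mu0 premeasure_sigma_subadditive.

(* The product of the uniform measures on {0, 1}: the Caratheodory extension of
   the proportion of clopen sets, with value 2^-|s| on the cylinder of s. *)
Definition coin := measure_extension mu0.

HB.instance Definition _ := Measure.on coin.

Lemma coin_cylinder s : coin (cylinder s) = (2 ^- size s)%:E.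
Proof.
transitivity (mu0 (cylinder s)).
  exact: (measurable_mu_extE mu0 (cylinder_clopen s)).
rewrite (@premeasure_density (size s)); last first.
  by move=> x y; rewrite /cylinder /= => ->.
rewrite /density.
rewrite (eq_card (B := pred1 (in_tuple s))) ?card1 ?mul1r// => t.
rewrite !inE; apply/idP/eqP => [/set_mem|->].
  rewrite /cylinder /mkset -[X in restr _ X](size_tuple t) restr_pad => e.
  exact: val_inj.
by apply/mem_set; rewrite /cylinder /mkset restr_pad.
Qed.

Lemma coin_setT : coin setT = 1%E.
Proof.
have -> : [set: clopen_space] = cylinder [::] by apply/seteqP; split.
by rewrite coin_cylinder /= expr0 invr1.
Qed.

HB.instance Definition _ := Measure_isProbability.Build _ _ R coin coin_setT.

End coin_measure.

(* Contained in a Borel set of measure 0: A itself need not be Borel. *)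
Definition null (R : realType) (A : set cantor_space) : Prop :=
  (coin R).-negligible A.

Definition is_tree (T : set (seq bool)) : Prop :=
  T !=set0 /\ forall s t, prefix s t -> T t -> T s.

Definition split_nodes (T : set (seq bool)) : set (seq bool) :=
  [set s | [/\ T s, T (rcons s false) & T (rcons s true)]].

Definition branches (T : set (seq bool)) : set cantor_space :=
  [set x | forall n, T (restr x n)].

Definition perfect_tree (T : set (seq bool)) : Prop :=
  is_tree T /\ forall s, T s -> exists2 t, split_nodes T t & prefix s t.

Definition level (n : nat) : set (seq bool) := [set s | size s = n].

Definition uniformly_perfect_tree (T : set (seq bool)) : Prop :=
  perfect_tree T /\
  forall n, level n `&` T `<=` split_nodes T \/
            level n `&` split_nodes T = set0.

Definition cantor_add (x y : cantor_space) : cantor_space :=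
  fun n => x n (+) y n.

Definition sumset (A B : set cantor_space) : set cantor_space :=
  [set cantor_add a b | a in A & b in B].

(* A + B + ... + B with n summands B. *)
Fixpoint iter_sumset (A B : set cantor_space) (n : nat) : set cantor_space :=
  if n is m.+1 then sumset (iter_sumset A B m) B else A.

(* Main.v *)
Require Import Defs.
From mathcomp Require Import all_boot all_order all_algebra.
From mathcomp Require Import all_classical all_reals all_analysis.
From mathcomp Require Import zify.

(** A set is null iff it lies in the limsup of a sequence of clopen sets [D i]
    whose measures tend to [0] as fast as one likes ([null_lim_sup_small]); ask
    for measure at most [2 ^- (i * i)]. Each [D i] depends only on the first
    [L i] coordinates. Translating [D i] by a set [B] then only sees the
    restrictions of the elements of [B] to those coordinates, so adding [n]
    copies of [B] multiplies the measure of [D i] by at most the [n]-th power of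
    the number of these restrictions ([coin_iter_sumset]).

    If [B = [T']] and [T'] has at most [2 ^ i] nodes of length [L i] for every
    [i], the set [D i + n [T']] has measure at most [2 ^ (n * i) / 2 ^ (i * i)].
    For every fixed [n] this is summable in [i], so by Borel-Cantelli the limsup
    of these sets is null; it contains [A + n [T']] ([null_iter_sumset]).

    It remains to thin [T] out to a perfect tree branching that slowly. Attach
    to every finite binary code [u] a splitting node [g u] of [T] of length at
    least [L (size u)], in such a way that [g] of an extension of [u] by [b]
    extends [g u] followed by [b]. The initial segments of the [g u] form a
    perfect tree, and a node of length [L i] in it is determined by a code of
    length [i]. When [T] is uniformly perfect the length of [g u] can be made a
    function of the length of [u] alone, and then all the splitting nodes of the
    thinned tree lie on levels where every node splits. *)

Set Implicit Arguments.
Unset Strict Implicit.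
Unset Printing Implicit Defensive.

Import Order.TTheory GRing.Theory Num.Theory.

Local Open Scope classical_set_scope.

(** * Thinning out perfect trees *)

(** Codes are read from right to left: the most recent choice is the head of
    the list, so that extending a code is a [cons]. *)
Definition splitting_scheme (T : set (seq bool)) (g : seq bool -> seq bool) :=
  (forall u, split_nodes T (g u)) /\
  forall u b, prefix (rcons (g u) b) (g (b :: u)).

Definition scheme_tree (g : seq bool -> seq bool) : set (seq bool) :=
  [set t | exists u, prefix t (g u)].

Section scheme.
Variables (T : set (seq bool)) (g : seq bool -> seq bool).
Hypothesis gT : splitting_scheme T g.

Lemma scheme_prefix u v : prefix (g v) (g (u ++ v)).
Proof.
elim: u => [|b u IH] /=; first exact: prefix_refl.
apply: prefix_trans (gT.2 _ b); apply: prefix_trans IH _.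
exact: prefix_rcons.
Qed.

Lemma scheme_split u : split_nodes (scheme_tree g) (g u).
Proof.
split; first by exists u; exact: prefix_refl.
- by exists (false :: u); exact: gT.2.
- by exists (true :: u); exact: gT.2.
Qed.

Lemma scheme_tree_sub : is_tree T -> scheme_tree g `<=` T.
Proof. by move=> [_ Tp] t [u /Tp]; apply; case: (gT.1 u). Qed.

Lemma scheme_tree_perfect : perfect_tree (scheme_tree g).
Proof.
split; last by move=> s [u su]; exists (g u) => //; exact: scheme_split.
split; first by exists (g [::]), [::]; exact: prefix_refl.
by move=> s t st [u tu]; exists u; exact: prefix_trans st tu.
Qed.

(** A node below [g (w ++ u)] that is no longer than [g u] is already an initial
    segment of [g u], because both are initial segments of [g (w ++ u)]. Hence a
    level lying below all the [g u] with [size u = i] has at most [2 ^ i]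
    nodes. *)
Lemma scheme_tree_rank t i : scheme_tree g t ->
  (forall u, size u = i -> size t <= size (g u)) ->
  exists2 u, size u = i & t = take (size t) (g u).
Proof.
move=> [v tv] le.
have [w [u [su tw]]] : exists w u, size u = i /\ prefix t (g (w ++ u)).
  have [iv|vi] := leqP i (size v).
    exists (take (size v - i) v), (drop (size v - i) v).
    by rewrite cat_take_drop size_drop subKn.
  exists [::], (nseq (i - size v) false ++ v); split.
    by rewrite size_cat size_nseq subnK// ltnW.
  by apply: prefix_trans tv _; exact: scheme_prefix.
exists u => //.
move: tw (scheme_prefix w u); rewrite !prefixE => /eqP tw /eqP gu.
rewrite -[in LHS]tw -[in RHS]gu take_takel ?(le u su)//.
Qed.

(** The codes can be read off the nodes: the choice [b] is the entry of
    [g (b :: v)] at position [size (g v)]. *)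
Lemma scheme_inj (k : nat -> nat) : (forall u, size (g u) = k (size u)) ->
  forall u v, size u = size v -> g u = g v -> u = v.
Proof.
move=> gk; elim=> [|a u IH] [|b v]//= [uv] guv.
have := gT.2 v b; have := gT.2 u a; rewrite guv !prefixE.
have -> : size (rcons (g u) a) = size (rcons (g v) b).
  by rewrite !size_rcons !gk uv.
by move=> /eqP -> /eqP /rcons_inj[/(IH _ uv) -> ->].
Qed.

(** The nodes of length [k i] are exactly the [g u] with [size u = i], and these
    split. Strictly between [k i] and [k i.+1] nothing splits: two successors of
    a node would be initial segments of [g u] and [g v] with [u] and [v] of
    length [i.+1], and the common part already determines the codes, by
    injectivity. *)
Lemma scheme_tree_uniform (k : nat -> nat) :
  (forall u, size (g u) = k (size u)) ->
  uniformly_perfect_tree (scheme_tree g).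
Proof.
move=> gk; split; first exact: scheme_tree_perfect.
have kS i : (k i < k i.+1)%N.
  have := size_prefix (gT.2 (nseq i false) false).
  by rewrite size_rcons !gk /= size_nseq.
have ki i : (i <= k i)%N.
  by elim: i => // i IH; exact: leq_ltn_trans IH (kS i).
have rank n i t : size t = n -> scheme_tree g t -> (n <= k i)%N ->
    exists2 u, size u = i & t = take n (g u).
  move=> <- /scheme_tree_rank h tk; apply: h => u ui.
  by rewrite gk ui.
move=> n; have [i ni minI] := ex_minnP (ex_intro (fun i => n <= k i)%N n (ki n)).
(* i is least with n <= k i, so the nodes of length n and n.+1 have codes of
   length i unless n = k i. *)
move: ni; rewrite leq_eqVlt => /predU1P[nk|nk].
  left=> t [/= tn tT]; have [|u ui ->] := rank n i t tn tT; first by rewrite nk.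
  by rewrite take_oversize ?gk ?ui ?nk//; exact: scheme_split.
right; rewrite -subset0 => t /= [tn [_ t0 t1]].
have Hrank b : scheme_tree g (rcons t b) ->
    exists2 u, size u = i & rcons t b = take n.+1 (g u).
  by move=> tT; apply: rank => //; rewrite size_rcons tn.
have [[u ui tu] [v vi tv]] := (Hrank _ t0, Hrank _ t1).
suff uv : u = v by move: tv; rewrite -uv -tu => /rcons_inj[].
have tE w c : rcons t c = take n.+1 (g w) -> t = take n (g w).
  move=> /(congr1 (take n)); rewrite take_takel// => <-.
  by rewrite -cats1 takel_cat ?tn// take_oversize ?tn.
(* Below k 0 there is only the empty code; above, t is longer than the nodes
   coded by the tails of u and v, and extends them by the heads. *)
case: i => [|i] in nk minI ui vi {Hrank} *; first by move/size0nil: ui => ->; move/size0nil: vi.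
case: u v ui vi tu tv => [|a u] [|b v]//= [ui] [vi] /tE tu /tE tv.
have kn : (k i < n)%N by rewrite ltnNge; apply/negP => /minI; rewrite ltnn.
have gt w c : size w = i -> t = take n (g (c :: w)) -> rcons (g w) c = take (k i).+1 t.
  move=> wi ->; rewrite take_takel//.
  by have := gT.2 w c; rewrite prefixE size_rcons gk wi => /eqP ->.
have := gt _ _ ui tu; rewrite -(gt _ _ vi tv) => /rcons_inj[guv ->].
by rewrite (scheme_inj gk _ guv)// ui.
Qed.

End scheme.

(** Recursion along codes. The relation [Q k n m] constrains the length [m] of
    the splitting node chosen, for a code of length [k], above a node of length
    [n]; it serves both for a lower bound on [m] and for prescribing [m]. *)
Lemma scheme_of_extension T (Q : nat -> nat -> nat -> Prop) : is_tree T ->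
  (forall k t, T t -> exists s,
     [/\ split_nodes T s, prefix t s & Q k (size t) (size s)]) ->
  exists g, [/\ splitting_scheme T g, Q 0%N 0%N (size (g [::])) &
    forall b u, Q (size u).+1 (size (g u)).+1 (size (g (b :: u)))].
Proof.
move=> [[t0 Tt0] Tp] ex.
have [ext extP] : exists ext : nat -> seq bool -> seq bool, forall k t, T t ->
    [/\ split_nodes T (ext k t), prefix t (ext k t) &
        Q k (size t) (size (ext k t))].
  suff /choice[f fP] : forall p : nat * seq bool, exists s, T p.2 ->
      [/\ split_nodes T s, prefix p.2 s & Q p.1 (size p.2) (size s)].
    by exists (fun k t => f (k, t)) => k t; exact: fP (k, t).
  move=> [k t]; have [/(ex k) [s sP]|nT] := pselect (T t); first by exists s.
  by exists [::].
pose g := fix g u := if u is b :: v then ext (size u) (rcons (g v) b)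
                     else ext 0%N [::].
have T0 : T [::] by apply: Tp Tt0; exact: prefix0s.
have gs u : split_nodes T (g u).
  elim: u => [|b u [_ gf gt]] /=; first by case: (extP 0%N _ T0).
  by have /(extP (size u).+1) [] : T (rcons (g u) b) by case: b.
have gb u b : T (rcons (g u) b) by case: (gs u) b => ? ? ? [].
exists g; split; first split=> // u b.
- by case: (extP (size u).+1 _ (gb u b)).
- by case: (extP 0%N _ T0).
- by move=> b u; rewrite -(size_rcons (g u) b); case: (extP (size u).+1 _ (gb u b)).
Qed.

Lemma split_extension T N t : perfect_tree T -> T t ->
  exists s, [/\ split_nodes T s, prefix t s & (N <= size s)%N].
Proof.
move=> [_ Tperf] Tt.
suff [s [Ts ts Ns]] : exists s, [/\ T s, prefix t s & (N <= size s)%N].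
  have [r rs sr] := Tperf s Ts; exists r; split => //.
    exact: prefix_trans ts sr.
  by apply: leq_trans Ns _; exact: size_prefix.
elim: N => [|N [s [Ts ts Ns]]]; first by exists t; split => //; exact: prefix_refl.
have [r [_ r0 _] sr] := Tperf s Ts; exists (rcons r false); split => //.
  by apply: prefix_trans (prefix_rcons _ _); exact: prefix_trans ts sr.
by rewrite size_rcons ltnS (leq_trans Ns)// size_prefix.
Qed.

Lemma perfect_scheme T (L : nat -> nat) : perfect_tree T ->
  exists2 g, splitting_scheme T g & forall u, (L (size u) <= size (g u))%N.
Proof.
move=> Tp; have [|k t Tt|g [gT g0 gS]] :=
  @scheme_of_extension T (fun k _ m => L k <= m)%N; first by case: Tp.
- exact: split_extension.
- by exists g => // -[|b u]; [exact: g0|exact: gS].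
Qed.

Lemma perfect_extension_at T m t : perfect_tree T -> T t -> (size t <= m)%N ->
  exists s, [/\ T s, prefix t s & size s = m].
Proof.
move=> Tp Tt tm; have [s [[Ts _ _] ts ms]] := split_extension m Tp Tt.
exists (take m s); split; last by rewrite size_takel.
  by apply: Tp.1.2 Ts; exact: prefix_take.
by move: ts; rewrite !prefixE take_takel.
Qed.

(** Beyond any length there is a level on which all the nodes of [T] split, so
    the next node can be sought on a level that depends only on the length of the
    current one. *)
Lemma uniformly_perfect_scheme T (L : nat -> nat) : uniformly_perfect_tree T ->
  exists g, [/\ splitting_scheme T g, forall u, (L (size u) <= size (g u))%N &
    exists k : nat -> nat, forall u, size (g u) = k (size u)].
Proof.
move=> [Tp Tu].
have [[t0 Tt0] _] := Tp.1.
have /choice[f fP] : forall N, exists m, (N <= m)%N /\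
    level m `&` T `<=` split_nodes T.
  move=> N; have [s [ss _ Ns]] := split_extension N Tp Tt0.
  exists (size s); split => //; case: (Tu (size s)) => // /seteqP[/(_ s)].
  by case.
have [|k t Tt|g [gT g0 gS]] :=
  @scheme_of_extension T (fun k n m => m = f (maxn (L k) n)); first by case: Tp.
- have [fm fs] := fP (maxn (L k) (size t)).
  have [|s [Ts ts sm]] := @perfect_extension_at T (f (maxn (L k) (size t))) t Tp Tt.
    by apply: leq_trans fm; rewrite leq_maxr.
  by exists s; split=> //; apply: fs.
exists g; split=> //.
  case=> [|b u]; rewrite ?g0 ?gS; apply: leq_trans (fP _).1; exact: leq_maxl.
pose k := fix k n := if n is m.+1 then f (maxn (L n) (k m).+1)
                     else f (maxn (L 0%N) 0%N).
by exists k; elim=> [//|b u IH]; rewrite gS IH.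
Qed.

Local Open Scope ring_scope.

(** * Counting restrictions in sumsets *)

Definition restr_tuple m (x : cantor_space) : m.-tuple bool :=
  [tuple of mkseq x m].

Definition trace m (B : set cantor_space) : {set m.-tuple bool} :=
  [set s : m.-tuple bool | `[< exists2 x, B x & restr x m = s >]]%SET.

Lemma mem_trace m (B : set cantor_space) (s : m.-tuple bool) :
  reflect (exists2 x, B x & restr x m = s) (s \in trace m B).
Proof. by rewrite inE; exact: asboolP. Qed.

Lemma trace_determined m C (s : m.-tuple bool) : determined C m ->
  (s \in trace m C) = (pad s \in C).
Proof.
move=> dC; apply/mem_trace/idP => [[x Cx xs]|/set_mem Cs].
  apply/mem_set; apply: dC Cx; rewrite xs.
  by rewrite -[X in restr _ X](size_tuple s) restr_pad.
by exists (pad s) => //; rewrite -[X in restr _ X](size_tuple s) restr_pad.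
Qed.

Lemma density_trace (R : realType) m C : determined C m ->
  density R m C = #|trace m C|%:R / 2 ^+ m.
Proof.
move=> dC; congr (_%:R / _); apply: eq_card => s.
by rewrite trace_determined// inE.
Qed.

Lemma card_trace_scheme T g (L : nat -> nat) i : splitting_scheme T g ->
  (forall u, (L (size u) <= size (g u))%N) ->
  (#|trace (L i) (branches (scheme_tree g))| <= 2 ^ i)%N.
Proof.
move=> gT Lg.
pose f (u : i.-tuple bool) := restr_tuple (L i) (pad (g u)).
apply: (@leq_trans #|f @: [set: i.-tuple bool]%SET|); last first.
  by rewrite (leq_trans (leq_imset_card _ _))// cardsT card_tuple card_bool.
apply/subset_leq_card/fintype.subsetP => t /mem_trace[x Bx xt].
have [u ui|u ui xu] := scheme_tree_rank (i := i) gT (Bx (L i)).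
  by rewrite size_restr -ui.
apply/imsetP; exists (Tuple (introT eqP ui)); first by rewrite inE.
apply: val_inj => /=; rewrite -xt xu size_restr -restr_pad_le//.
by rewrite -ui.
Qed.

Lemma restr_pad_tuple m x : restr (pad (restr_tuple m x)) m = restr x m.
Proof. by apply/restrP => i im; rewrite /pad /= nth_mkseq. Qed.

Lemma cantor_addK x y : cantor_add (cantor_add x y) y = x.
Proof. by apply/funext => n; rewrite /cantor_add addbK. Qed.

Lemma restr_add x y x' y' m : restr x m = restr x' m -> restr y m = restr y' m ->
  restr (cantor_add x y) m = restr (cantor_add x' y') m.
Proof.
move=> /restrP xx /restrP yy; apply/restrP => i im.
by rewrite /cantor_add xx ?yy.
Qed.

(** If [y] agrees with [e + b] on the first [m] coordinates, then [y + b] agrees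
    with [e], since every element is its own opposite. *)
Lemma sumset_determined m E B : determined E m -> determined (sumset E B) m.
Proof.
move=> dE x y xy [e Ee [b Bb ebx]].
exists (cantor_add y b); last by exists b => //; rewrite cantor_addK.
by apply: dE Ee; rewrite -(cantor_addK e b) ebx; exact: restr_add.
Qed.

Lemma card_trace_sumset m E B :
  (#|trace m (sumset E B)| <= #|trace m E| * #|trace m B|)%N.
Proof.
rewrite -cardsX.
pose f (p : m.-tuple bool * m.-tuple bool) :=
  restr_tuple m (cantor_add (pad p.1) (pad p.2)).
apply: leq_trans (leq_imset_card f _).
apply/subset_leq_card/fintype.subsetP => t /mem_trace[_ [e Ee [b Bb <-]] xt].
apply/imsetP; exists (restr_tuple m e, restr_tuple m b).
  by rewrite inE/=; apply/andP; split; apply/mem_trace; [exists e | exists b].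
apply: val_inj => /=; rewrite -xt.
by apply: restr_add; apply/esym; exact: restr_pad_tuple.
Qed.

Lemma iter_sumset_determined m E B n :
  determined E m -> determined (iter_sumset E B n) m.
Proof. by move=> dE; elim: n => //= n; exact: sumset_determined. Qed.

Lemma card_trace_iter_sumset m E B n :
  (#|trace m (iter_sumset E B n)| <= #|trace m E| * #|trace m B| ^ n)%N.
Proof.
elim: n => [|n IH] /=; first by rewrite muln1.
apply: leq_trans (card_trace_sumset _ _ _) _.
by rewrite expnSr mulnA leq_mul2r IH orbT.
Qed.

Lemma sumsetS A A' B : A `<=` A' -> sumset A B `<=` sumset A' B.
Proof. by move=> AA' x [a /AA' A'a [b Bb <-]]; exists a => //; exists b. Qed.

Lemma iter_sumsetS A A' B n :
  A `<=` A' -> iter_sumset A B n `<=` iter_sumset A' B n.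
Proof. by move=> AA'; elim: n => //= n; exact: sumsetS. Qed.

Lemma iter_sumset_point A B n x : iter_sumset A B n x ->
  exists2 a, A a & iter_sumset [set a] B n x.
Proof.
elim: n x => [|n IH] x /=; first by exists x.
move=> [y /IH[a Aa ay] [b Bb <-]]; exists a => //; exists y => //.
by exists b.
Qed.

(** An element of the sumset comes from a single point of [A], which stays in
    infinitely many of the [D i]. *)
Lemma iter_sumset_lim_sup A (D : nat -> set cantor_space) B n :
  A `<=` lim_sup_set D ->
  iter_sumset A B n `<=` lim_sup_set (fun i => iter_sumset (D i) B n).
Proof.
move=> AD x /iter_sumset_point[a /AD aD ax] k _.
have [j kj Dj] := aD k I; exists j => //.
by apply: iter_sumsetS ax => _ ->.
Qed.

(** * The measure of a set given by finitely many coordinates *)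

Lemma determined_clopen C m : determined C m -> clopen C.
Proof.
suff op E : determined E m -> open E.
  move=> dC; split; first exact: op.
  rewrite -openC; apply: op => x y xy nCx Cy; apply: nCx.
  by apply: dC Cy.
move=> dE; have -> : E = \bigcup_(x in E) cylinder (restr x m).
  apply/seteqP; split=> [x Ex|y [x Ex]].
    by exists x => //; rewrite /cylinder /mkset size_restr.
  rewrite /cylinder /mkset size_restr => yx.
  by apply: dE Ex.
by apply: bigcup_open => x _; case: (cylinder_clopen (restr x m)).
Qed.

Lemma coin_clopen (R : realType) (C : set cantor_space) m : determined C m ->
  coin R C = (density R m C)%:E.
Proof.
move=> dC; rewrite -premeasure_density//.
exact: (measurable_mu_extE (@premeasure R) (determined_clopen dC)).
Qed.

Lemma measurable_clopen (C : set cantor_space) : clopen C ->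
  measurable (C : set (g_sigma_algebraType (@measurable _ clopen_space))).
Proof. by move=> cC; exact: sub_sigma_algebra. Qed.

(** Both sets are determined by the first [m] coordinates, so the measures are
    numbers of restrictions divided by [2 ^ m], and restrictions of sums are sums
    of restrictions. *)
Lemma coin_iter_sumset (R : realType) E B m n c : determined E m ->
  (#|trace m B| <= c)%N ->
  (coin R (iter_sumset E B n) <= coin R E * (c ^ n)%:R%:E)%E.
Proof.
move=> dE Bc; rewrite !(@coin_clopen _ _ m)//; last exact: iter_sumset_determined.
rewrite -EFinM lee_fin !density_trace//; last exact: iter_sumset_determined.
rewrite mulrAC ler_pM2r ?invr_gt0 ?exprn_gt0// -natrM ler_nat.
apply: leq_trans (card_trace_iter_sumset _ _ _ _) _.
by apply: leq_mul => //; case: n => // n; rewrite leq_exp2r.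
Qed.

(** * Null sets as upper limits of clopen sets *)

Lemma null_cover (R : realType) A (e : R) : 0 < e -> null R A ->
  exists F : nat -> set cantor_space, [/\ forall i, clopen (F i),
    A `<=` \bigcup_i F i & (\sum_(i <oo) coin R (F i) <= e%:E)%E].
Proof.
move=> e0 [B [_ B0 AB]].
have : mu_ext (@premeasure R) B = 0%E := B0.
rewrite /mu_ext; set S := (X in ereal_inf X) => S0.
have := @lb_ereal_inf_adherent R S e e0; rewrite S0 => /(_ isT).
move=> [_ [F [Fm BF] <-]]; rewrite add0e => /ltW Fe.
exists F; split => //; first exact: subset_trans AB BF.
apply: le_trans Fe; apply: lee_nneseries => i // _.
by rewrite /coin /measure_extension measurable_mu_extE.
Qed.

(** Cover [A], for every [k], by clopen sets of total measure at most
    [1 / 2 ^ k.+1], and enumerate all these sets together. *)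
Lemma null_lim_sup (R : realType) A : null R A ->
  exists C : nat -> set cantor_space, [/\ forall j, clopen (C j),
    (\sum_(j <oo) coin R (C j) < +oo)%E & A `<=` lim_sup_set C].
Proof.
move=> nA.
have e0 k : 0 < 1 / (2 ^ k.+1)%:R :> R by rewrite divr_gt0// ltr0n expn_gt0.
have /choice[F FP] := fun k => null_cover (e0 k) nA.
have /card_esym/ppcard_eqP[f] := card_nat2.
pose C j := F (f j).1 (f j).2.
exists C; split.
- by move=> j; have [cF _ _] := FP (f j).1; exact: cF.
- rewrite nneseries_esumT//.
  rewrite -(@reindex_esum R _ _ setT setT f (fun p => coin R (F p.1 p.2)))//.
  have -> : [set: nat * nat] = [set: nat] `*`` (fun=> [set: nat]).
    by apply/seteqP; split => // p _; split.
  rewrite -(@esum_esum _ _ _ _ _ (fun k i => coin R (F k i)))//.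
  apply: (@le_lt_trans _ _ 1%E); last exact: ltry.
  rewrite -nneseries_esumT; last by move=> k; apply: esum_ge0 => *; exact: measure_ge0.
  apply: le_trans (@epsilon_trick0 R 1 xpredT ler01).
  apply: lee_nneseries => k; first by move=> *; apply: esum_ge0 => *; exact: measure_ge0.
  by rewrite -nneseries_esumT//; case: (FP k).
move=> x Ax n _.
(* With k larger than the first index of C 0, ..., C n.-1, a set covering x in
   the k-th cover is enumerated at position n or later. *)
pose k := (\max_(j < n) (f j).1).+1.
have [_ /(_ x Ax) [i _ xi] _] := FP k.
exists (f^-1%FUN (k, i)); last by rewrite /C invK ?inE.
rewrite /= leqNgt; apply/negP => ltn.
have := @leq_bigmax _ (fun j : 'I_n => (f j).1) (Ordinal ltn).
by rewrite /= invK ?inE//= ltnn.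
Qed.

(** Cut the convergent series of the measures of the [C j] into blocks so late
    that the tail from the [i]-th block on is at most [eps i], and let [D i] be
    the union of the [i]-th block. *)
Lemma null_lim_sup_small (R : realType) (eps : nat -> R) A :
  (forall i, 0 < eps i) -> null R A ->
  exists D : nat -> set cantor_space, [/\ forall i, clopen (D i),
    forall i, (coin R (D i) <= (eps i)%:E)%E & A `<=` lim_sup_set D].
Proof.
move=> eps0 /null_lim_sup[C [cC Coo AC]].
have /choice[N NP] i : exists N, forall n, (N <= n)%N ->
    (\sum_(n <= j <oo) coin R (C j) <= (eps i)%:E)%E.
  have := @nneseries_tail_cvg R (fun j => coin R (C j)) xpredT Coo (fun j _ => measure_ge0 _ _).
  move=> /fine_cvgP[] [N1 _ fN] /cvgrPdist_le /(_ _ (eps0 i)) [N2 _ leN].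
  exists (maxn N1 N2) => n; rewrite geq_max => /andP[/fN fn /leN].
  rewrite /= sub0r normrN => /(le_trans (ler_norm _)).
  by rewrite -lee_fin fineK.
(* M i is where the i-th block starts; it is made strictly increasing so that
   the blocks exhaust all large j. *)
pose M := fix M i := if i is k.+1 then maxn (N i) (M k).+1 else N 0%N.
have NM i : (N i <= M i)%N by case: i => //= i; rewrite leq_maxl.
have MS i : (M i < M i.+1)%N by rewrite /= leq_maxr.
have iM i : (i <= M i)%N by elim: i => // i IH; exact: leq_ltn_trans (MS i).
pose D i := \big[setU/set0]_(j <- index_iota (M i) (M i.+1)) C j.
have clD i : clopen (D i).
  by rewrite /D; elim/big_ind: _ => //; [exact: clopen0 | exact: clopenU].
exists D; split=> // [i|x /AC xC n _].
  apply: le_trans (NP i _ (NM i)).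
  apply: measure_sigma_subadditive_tail.
  - by move=> j; exact: measurable_clopen.
  - exact: measurable_clopen.
  rewrite /D -bigcup_seq => x [j /=]; rewrite mem_index_iota => /andP[Mj _ xj].
  by exists j => //=; apply/negP; rewrite -leqNgt.
have [j /= Mj xj] := xC (M n) I.
(* j lies in the block preceding the first one that starts after j. *)
have [|k jk mink] := @ex_minnP (fun k => (j < M k)%N); first by exists j.+1; exact: iM.
have nk : (n < k)%N.
  rewrite ltnNge; apply/negP => kn.
  have : {homo M : a b / (a <= b)%N}.
    by apply: homo_leq => // [a b c|a]; [exact: leq_trans | exact/ltnW].
  by move=> /(_ _ _ kn) Mkn; move: (leq_trans jk Mkn); rewrite ltnNge Mj.
case: k => // k in jk mink nk *.
exists k; first by [].
rewrite /D -bigcup_seq; exists j => //=; rewrite mem_index_iota jk andbT leqNgt.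
by apply/negP => /mink; rewrite ltnn.
Qed.

(** * Sumsets of null sets and thin trees *)

Lemma lim_sup_null (R : realType) A (E : nat -> set cantor_space) (c : R) :
  (forall i, clopen (E i)) -> (forall i, coin R (E i) <= (c / 2 ^+ i)%:E)%E ->
  A `<=` lim_sup_set E -> null R A.
Proof.
move=> cE Ec AE; exists (lim_sup_set E); split=> //.
  apply: bigcap_measurable => [|k _]; first by exists 0%N.
  by apply: bigcup_measurable => j _; exact: measurable_clopen.
apply: lim_sup_set_cvg0; first by move=> k; exact: measurable_clopen.
have c0 : 0 <= c.
  by have := le_trans (measure_ge0 _ _) (Ec 0%N); rewrite lee_fin divr1.
apply: (@le_lt_trans _ _ (c * 2)%:E); last exact: ltry.
apply: le_trans (epsilon_trick0 xpredT (mulr_ge0 c0 (ler0n _ 2))).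
apply: lee_nneseries => // i _; apply: le_trans (Ec i) _.
by rewrite lee_fin natrX exprS invfM mulrA mulfK.
Qed.

(** The measure of the [i]-th summed set is at most [2 ^ (n * i) / 2 ^ (i * i)],
    and [n.+1 * i <= i * i + n.+1 * n.+1] turns this into a geometric bound valid
    for every [i]. *)
Lemma null_iter_sumset (R : realType) A (D : nat -> set cantor_space)
    (L : nat -> nat) B n :
  (forall i, determined (D i) (L i)) ->
  (forall i, coin R (D i) <= ((2 ^+ (i * i))^-1)%:E)%E ->
  A `<=` lim_sup_set D ->
  (forall i, (#|trace (L i) B| <= 2 ^ i)%N) ->
  null R (iter_sumset A B n).
Proof.
move=> dD Dle AD Bc.
apply: (@lim_sup_null R _ _ (2 ^+ (n.+1 * n.+1))) (iter_sumset_lim_sup AD).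
  by move=> i; apply: determined_clopen; exact: iter_sumset_determined (dD i).
move=> i; apply: le_trans (coin_iter_sumset R n (dD i) (Bc i)) _.
apply: (@le_trans _ _ ((2 ^+ (i * i))^-1 * ((2 ^ i) ^ n)%N%:R)%:E).
  by rewrite EFinM lee_wpmul2r// lee_fin.
rewrite lee_fin mulrC ler_pdivrMr ?exprn_gt0// mulrAC ler_pdivlMr ?exprn_gt0//.
rewrite !natrX -!exprM -!exprD ler_weXn2l ?ler1n//.
by case: (leqP i n) => ?; nia.
Qed.

(** The lengths [L] depend on [A] only, so they are available before the scheme
    in a given tree is chosen. *)
Lemma null_scheme (R : realType) A : null R A ->
  exists L : nat -> nat, forall T g, splitting_scheme T g ->
    (forall u, (L (size u) <= size (g u))%N) ->
    forall n, null R (iter_sumset A (branches (scheme_tree g)) n).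
Proof.
move=> nA; pose eps i : R := (2 ^+ (i * i))^-1.
have [|D [cD De AD]] := @null_lim_sup_small R eps A _ nA.
  by move=> i; rewrite invr_gt0 exprn_gt0.
have /choice[L dL] := fun i => clopen_determined (cD i).
exists L => T g gT Lg n; apply: null_iter_sumset dL De AD _ => i.
exact: card_trace_scheme gT Lg.
Qed.

Theorem corollary14 (R : realType) :
  (forall (A : set cantor_space) (T : set (seq bool)),
     null R A -> perfect_tree T ->
     exists T' : set (seq bool),
       [/\ perfect_tree T', T' `<=` T &
           forall n : nat, null R (iter_sumset A (branches T') n)]) /\
  (forall (A : set cantor_space) (T : set (seq bool)),
     null R A -> uniformly_perfect_tree T ->
     exists T' : set (seq bool),
       [/\ uniformly_perfect_tree T', T' `<=` T &
           forall n : nat, null R (iter_sumset A (branches T') n)]).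
Proof.
split=> A T /null_scheme[L nL] Tp.
- have [g gT Lg] := perfect_scheme L Tp.
  exists (scheme_tree g); split; first exact: scheme_tree_perfect gT.
    by apply: scheme_tree_sub gT _; case: Tp.
  exact: nL gT Lg.
- have [g [gT Lg [k gk]]] := uniformly_perfect_scheme L Tp.
  exists (scheme_tree g); split; first exact: (scheme_tree_uniform gT gk).
    by apply: scheme_tree_sub gT _; case: Tp.1.
  exact: nL gT Lg.
Qed.
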